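(* Let $n\ge2$, $\alpha\in\mathbf N$, and let $X_1,\dots,X_n$ be random variables with one-dimensional cdf's $F_1,\dots,F_n$, whose joint cdf is absolutely continuous with respect to $\prod_{k=1}^nF_k(x_k)$. Let $\xi_1,\dots,\xi_n$ be independent random variables with cdf's $F_1,\dots,F_n$, and let $g_{i_1,\dots,i_c}$ be the canonical functions of the joint distribution of $X_1,\dots,X_n$. Then $X_1,\dots,X_n$ form a multiplicative system of order $\alpha$ if and only if $$E\,\xi_{i_1}^{\alpha_{i_1}}\cdots\xi_{i_c}^{\alpha_{i_c}}\,g_{i_1,\dots,i_c}(\xi_{i_1},\dots,\xi_{i_c})=0$$ for all $1\le i_1<\dots<i_c\le n$, $c=2,\dots,n$, and all $\alpha_j\in\{0,1,\dots,\alpha\}$, $j=1,\dots,n$.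
   Context: Random variables $X_1,\dots,X_n$ form a multiplicative system of order $\alpha\in\mathbf N$ if $E|X_j|^\alpha<\infty$, $j=1,\dots,n$, and $E\prod_{j=1}^nX_j^{\alpha_j}=\prod_{j=1}^nEX_j^{\alpha_j}$ for any $\alpha_j\in\{0,1,\dots,\alpha\}$, $j=1,\dots,n$. Canonical functions: if the joint cdf $F$ of $X_1,\dots,X_n$ is absolutely continuous with respect to the product of its marginals, i.e. $F(x_1,\dots,x_n)=\int_{-\infty}^{x_1}\cdots\int_{-\infty}^{x_n}G\,dF_1\cdots dF_n$ for some Borel $G\ge0$, then there exist Borel functions $g_{i_1,\dots,i_c}:\mathbf R^c\to\mathbf R$, $1\le i_1<\dots<i_c\le n$, $c=2,\dots,n$, with: (A1) $E|g_{i_1,\dots,i_c}(\xi_{i_1},\dots,\xi_{i_c})|<\infty$; (A2) $E(g_{i_1,\dots,i_c}(\xi_{i_1},\dots,\xi_{i_c})\mid\xi_{i_1},\dots,\xi_{i_{k-1}},\xi_{i_{k+1}},\dots,\xi_{i_c})=0$ (a.s.) for $k=1,\dots,c$; (A3) $U_n(\xi_1,\dots,\xi_n):=\sum_{c=2}^n\sum_{1\le i_1<\dots<i_c\le n}g_{i_1,\dots,i_c}(\xi_{i_1},\dots,\xi_{i_c})\ge-1$ (a.s.); and $$F(x_1,\dots,x_n)=\int_{-\infty}^{x_1}\cdots\int_{-\infty}^{x_n}(1+U_n(t_1,\dots,t_n))\prod_{i=1}^ndF_i(t_i).$$ The random variables $g_{i_1,\dots,i_c}(\xi_{i_1},\dots,\xi_{i_c})$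 are a.s. uniquely determined by $F$. These $g_{i_1,\dots,i_c}$ are called here the canonical functions of the joint distribution.
   Formalization: The finiteness of E|X_j|^α for all j is assumed throughout; without it the ''if'' part fails, e.g. for independent Cauchy X_j, where all canonical functions vanish but E|X_j|^α is infinite for α ≥ 1. *)

(* Defs.v *)
From HB Require Import structures.
From mathcomp Require Import all_boot all_order all_algebra.
From mathcomp Require Import all_classical all_reals all_analysis.

Set Implicit Arguments.
Unset Strict Implicit.
Unset Printing Implicit Defensive.

Import Order.TTheory GRing.Theory Num.Theory.
Import numFieldNormedType.Exports.

Local Open Scope classical_set_scope.
Local Open Scope ring_scope.

Definition random_vector (T R : Type) (n : nat) (X : 'I_n -> T -> R) (w : T)
  : n.-tuple R := [tuple X i w | i < n].

(* For A = {i_1 < ... < i_c}, subvector A t = (t_{i_1}, ..., t_{i_c}):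
   enum_val lists the elements of A in increasing order. *)
Definition subvector (R : Type) (n : nat) (A : {set 'I_n}) (t : n.-tuple R)
  : #|A|.-tuple R := [tuple tnth t (enum_val k) | k < #|A|].

Definition joint_cdf (R : realType) (d : measure_display)
    (T : measurableType d) (P : probability T R) (n : nat)
    (X : 'I_n -> {RV P >-> R}) (x : 'I_n -> R) : \bar R :=
  P [set w | forall i, X i w <= x i].

Definition mutually_independent (R : realType) (d : measure_display)
    (T : measurableType d) (P : probability T R) (n : nat)
    (X : 'I_n -> {RV P >-> R}) : Prop :=
  forall (J : {set 'I_n}) (B : 'I_n -> set R),
    (forall i, i \in J -> measurable (B i)) ->
    P (\bigcap_(i in [set` J]) (X i @^-1` B i)) =
    (\prod_(i in J) P (X i @^-1` B i))%E.

(* int_{-oo}^{x_1} ... int_{-oo}^{x_n} f dF_1 ... dF_n, the integral in the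
   first coordinate being the outermost one. *)
Fixpoint iterated_integral (R : realType) (n : nat) :
    ('I_n -> cumulativeBounded (0 : R) (1 : R)) -> ('I_n -> R) ->
    (n.-tuple R -> R) -> \bar R :=
  match n with
  | 0%N => fun _ _ f => (f [tuple])%:E
  | m.+1 => fun F x f =>
      (\int[lebesgue_stieltjes_measure (F ord0)]_(t in `]-oo, x ord0]%classic)
        iterated_integral (fun i => F (lift ord0 i)) (fun i => x (lift ord0 i))
          (fun s : m.-tuple R => f [tuple of t :: s]))%E
  end.

Definition abs_continuous_wrt_product (R : realType) (n : nat)
    (F : 'I_n -> cumulativeBounded (0 : R) (1 : R))
    (H : ('I_n -> R) -> \bar R) : Prop :=
  exists G : n.-tuple R -> R,
    [/\ measurable_fun setT G, forall t, 0 <= G t &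
        forall x, H x = iterated_integral F x G].

Definition sigma_generated (R : realType) (d : measure_display)
    (T : measurableType d) (P : probability T R) (n : nat)
    (X : 'I_n -> {RV P >-> R}) (D : {set 'I_n}) : set_system T :=
  g_sigma_preimage (fun k : 'I_#|D| => X (enum_val k) : T -> R).

(* Z is a version of the conditional expectation E(Y | S). *)
Definition is_cond_expectation (R : realType) (d : measure_display)
    (T : measurableType d) (P : probability T R) (S : set_system T)
    (Y Z : T -> R) : Prop :=
  [/\ P.-integrable setT (EFin \o Z),
      forall B : set R, measurable B -> S (Z @^-1` B) &
      forall C, S C ->
        (\int[P]_(w in C) (Z w)%:E = \int[P]_(w in C) (Y w)%:E)%E].

(* The values of g on sets of cardinality less than 2 play no role. *)
Definition U_stat (R : realType) (n : nat)
    (g : forall A : {set 'I_n}, #|A|.-tuple R -> R) (t : n.-tuple R) : R :=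
  \sum_(A : {set 'I_n} | (2 <= #|A|)%N) g A (subvector A t).

(* H is the joint cdf whose canonical functions are the g A; xi is the
   independent copy with marginal cdfs F. *)
Definition canonical_functions (R : realType) (d : measure_display)
    (T : measurableType d) (P : probability T R) (n : nat)
    (F : 'I_n -> cumulativeBounded (0 : R) (1 : R))
    (H : ('I_n -> R) -> \bar R) (xi : 'I_n -> {RV P >-> R})
    (g : forall A : {set 'I_n}, #|A|.-tuple R -> R) : Prop :=
  let g_xi A w := g A (subvector A (random_vector xi w)) in
  [/\ forall A : {set 'I_n}, (2 <= #|A|)%N -> measurable_fun setT (g A),
      forall A : {set 'I_n}, (2 <= #|A|)%N ->
        ('E_P[fun w => `|g_xi A w|%R] < +oo)%E,
      forall A : {set 'I_n}, (2 <= #|A|)%N -> forall k, k \in A ->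
        exists2 Z : T -> R,
          is_cond_expectation P (sigma_generated xi (A :\ k)) (g_xi A) Z &
          {ae P, forall w, Z w = 0},
      {ae P, forall w, -1 <= U_stat g (random_vector xi w)} &
      forall x, H x = iterated_integral F x (fun t => 1 + U_stat g t)].

(* Expectations are extended-real valued, and the integral of a measurable
   function is a real number only if the function is integrable; since the
   right-hand side below is real, the equality includes the existence of the
   mixed moment. *)
Definition multiplicative_system (R : realType) (d : measure_display)
    (T : measurableType d) (P : probability T R) (n : nat) (alpha : nat)
    (X : 'I_n -> {RV P >-> R}) : Prop :=
  (forall j, ('E_P[fun w => (`|X j w| ^+ alpha)%R] < +oo)%E) /\
  (forall a : 'I_n -> nat, (forall j, (a j <= alpha)%N) ->
     ('E_P[fun w => (\prod_(j < n) X j w ^+ a j)%R] =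
      \prod_(j < n) 'E_P[fun w => (X j w ^+ a j)%R])%E).

(* Main.v *)
(* Let mu be the law of xi and nu the law of X on R^n.  By hypothesis nu has
   density 1 + U_n with respect to mu, so the mixed moments of X are
   E[xi^a (1 + U_n(xi))].  If all E[xi_A^a g_A(xi_A)] vanish, independence of
   xi_A and the other coordinates gives E[xi^a g_A(xi_A)] = 0 and the moments
   factorize.  Conversely, by (A2) and independence, E(g_B | xi_A) = 0 unless
   B is contained in A; taking a supported in A and conditioning on xi_A gives
   E[xi_A^a sum_(B <= A) g_B(xi_B)] = 0, and one concludes by induction on #|A|.
   Conditioning on xi_A is integration in s over mix A (t, s), which has the
   coordinates of t on A and those of s off A; independence says that mix A
   maps mu x mu to mu. *)
Require Import Defs.
From HB Require Import structures.
From mathcomp Require Import all_boot all_order all_algebra.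
From mathcomp Require Import all_classical all_reals all_analysis.
From mathcomp Require Import measurable_realfun.

Set Implicit Arguments.
Unset Strict Implicit.
Unset Printing Implicit Defensive.

Import Order.TTheory GRing.Theory Num.Theory.
Import numFieldNormedType.Exports.

Local Open Scope classical_set_scope.
Local Open Scope ring_scope.

(** * Laws on tuples *)

Section mfun_of.
Context d1 d2 (T1 : measurableType d1) (T2 : measurableType d2).
Variables (f : T1 -> T2) (mf : measurable_fun setT f).

(** Packing the map lets [distribution] be applied, so that image measures come with their
    probability structure. *)
Definition mfun_of : {mfun T1 >-> T2} :=
  MeasurableFun.Pack (MeasurableFun.Class (isMeasurableFun.Build _ _ _ _ _ mf)).

End mfun_of.

(** The product measure of a null set is the integral of the measures of its sections. These are
    nonnegative, so almost every section is null. *)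
Lemma ae_xsection d1 d2 (T1 : measurableType d1) (T2 : measurableType d2)
    (R : realType) (m1 : {sigma_finite_measure set T1 -> \bar R})
    (m2 : {sigma_finite_measure set T2 -> \bar R}) (S : T1 * T2 -> Prop) :
  {ae (m1 \x m2)%E, forall p, S p} ->
  {ae m1, forall x, {ae m2, forall y, S (x, y)}}.
Proof.
move=> [N [mN N0 SN]].
have mx := measurable_fun_xsection m2 mN.
have : ae_eq m1 setT (m2 \o xsection N) (cst 0%E).
  apply/(ae_eq_integral_abs m1 measurableT mx).
  rewrite -[RHS]N0 /product_measure1; apply: eq_integral => x _ /=.
  by rewrite gee0_abs.
apply: filterS => x /(_ I) /= x0; exists (xsection N x); split => //.
  exact: measurable_xsection.
by move=> y /= nS; rewrite /xsection/= inE; exact: SN.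
Qed.

(** The integral is the difference of those of the positive and negative parts, and Tonelli makes
    each measurable in [x]. *)
Lemma measurable_integral_section d1 d2 (T1 : measurableType d1)
    (T2 : measurableType d2) (R : realType)
    (m : {sigma_finite_measure set T2 -> \bar R}) (D : set T2)
    (f : T1 * T2 -> \bar R) :
  measurable D -> measurable_fun setT f ->
  measurable_fun setT (fun x => \int[m]_(y in D) f (x, y))%E.
Proof.
move=> mD mf; pose fD := f \_ (setT `*` D).
have mfD : measurable_fun setT fD.
  apply/(measurable_restrictT f); first exact: measurableX.
  exact: measurable_funTS.
rewrite (_ : (fun _ => _) =
    fun x => (fubini_F m fD^\+ x - fubini_F m fD^\- x)%E).
  apply: emeasurable_funB; apply: measurable_fun_fubini_tonelli_F => //.
    exact: measurable_funepos.
  exact: measurable_funeneg.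
apply/funext => x; rewrite integral_mkcond integralE.
have E : ((fun y => f (x, y)) \_ D) = (fun y => fD (x, y)).
  apply/funext => y; rewrite /fD !patchE; congr (if _ then _ else _).
  by apply/idP/idP; rewrite !inE => // -[].
rewrite E /fubini_F; congr (_ - _)%E; apply: eq_integral => y _.
  by rewrite !funeposE.
by rewrite !funenegE.
Qed.

(** * Orthants as a generating pi-system *)

Section orthant.
Context (R : realType) (n : nat).

Definition orthant (x : 'I_n -> R) : set (n.-tuple R) :=
  [set t | forall i, tnth t i <= x i].

Lemma orthantE x :
  orthant x = \bigcap_(i in setT) ((@tnth n R ^~ i) @^-1` `]-oo, x i]).
Proof.
apply/seteqP; split => t /= H i.
  by move=> _ /=; rewrite in_itv/=.
by have := H i I; rewrite /= in_itv.
Qed.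

Lemma measurable_orthant x : measurable (orthant x).
Proof.
rewrite orthantE; apply: fin_bigcap_measurable.
  exact: (@finite_finset _ [set: ordinal n]).
by move=> i _; rewrite -[X in measurable X]setTI; exact: measurable_tnth.
Qed.

Lemma tuple_bounded (t : n.-tuple R) :
  exists k : nat, forall j, tnth t j <= k%:R.
Proof.
exists (\max_(j < n) (Num.truncn (tnth t j)).+1)%N => j.
rewrite (le_trans (ltW (Num.Theory.truncnS_gt _)))// ler_nat.
exact: (leq_bigmax j).
Qed.

Lemma orthant_cover (i : 'I_n) (a : R) :
  (@tnth n R ^~ i) @^-1` `]-oo, a] =
  \bigcup_(k : nat) orthant (fun j => if j == i then a else k%:R).
Proof.
apply/seteqP; split => [t|t [k _]] /=; rewrite in_itv/= => ta; last first.
  by have := ta i; rewrite eqxx.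
have [k tk] := tuple_bounded t; exists k => // j.
by case: eqVneq => [->|].
Qed.

(** It is enough that each coordinate be measurable for the sigma-algebra generated by orthants, and
    the half-spaces [tnth t i <= a] are countable unions of orthants by [orthant_cover]. *)
Lemma measurable_orthants :
  @measurable _ (n.-tuple R) = <<s range orthant >>.
Proof.
apply/seteqP; split; last first.
  apply: smallest_sub; first exact: sigma_algebra_measurable.
  by move=> _ [x _ <-]; exact: measurable_orthant.
pose G := g_sigma_algebraType (range orthant).
suff mid : measurable_fun (setT : set G) (fun t : G => t : n.-tuple R).
  by move=> A mA; have := mid measurableT A mA; rewrite setTI preimage_id.
apply/measurable_fun_tnthP => i.
apply: (measurability (@RGenOInfty.G R)) => [|_ [_ [a ->] <-]].
  exact: RGenOInfty.measurableE.
rewrite setTI /comp -[X in measurable X]setCK; apply: measurableC.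
rewrite (_ : ~` _ = (@tnth n R ^~ i) @^-1` `]-oo, a]); last first.
  apply/seteqP; split => t /=; rewrite !in_itv/= andbT leNgt; first by move/negP.
  by move/negP.
rewrite orthant_cover; apply: bigcupT_measurable => k.
by apply: sub_sigma_algebra; exists (fun j => if j == i then a else k%:R).
Qed.

(** Orthants are stable under intersection (coordinatewise minima), generate the sigma-algebra, and
    those with constant natural bounds exhaust the space, so uniqueness of measures on a pi-system
    applies. *)
Lemma orthant_unique (m1 m2 : {measure set (n.-tuple R) -> \bar R}) :
  (forall x, m1 (orthant x) = m2 (orthant x)) ->
  (forall x, (m1 (orthant x) < +oo)%E) ->
  forall A, measurable A -> m1 A = m2 A.
Proof.
move=> m12 moo; apply: (measure_unique (range orthant)
    (fun k => orthant (fun=> k%:R))) => //.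
- exact: measurable_orthants.
- move=> _ _ [x _ <-] [y _ <-]; exists (fun i => Num.min (x i) (y i)) => //.
  apply/seteqP; split => [t H|t [Hx Hy] i]; last by rewrite le_min Hx Hy.
  by split => i; have := H i; rewrite le_min => /andP[].
- apply/seteqP; split => // t _.
  by have [k tk] := tuple_bounded t; exists k.
- by move=> _ [x _ <-].
Qed.
End orthant.

(** * Iterated integrals *)

(** The parameter space [Y] varies in the induction: at each step the first coordinate joins the
    parameter. *)
Lemma measurable_iterated_integral (R : realType) (n : nat) :
  forall d (Y : measurableType d) (F : 'I_n -> cumulativeBounded (0 : R) (1 : R))
    (x : 'I_n -> R) (f : Y -> n.-tuple R -> R),
  measurable_fun setT (fun p : Y * n.-tuple R => f p.1 p.2) ->
  measurable_fun setT (fun y => iterated_integral F x (f y)).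
Proof.
elim: n => [|n IH] d Y F x f mf.
  by apply/measurable_EFinP; exact: (measurable_fun_pair1 [tuple] mf).
pose Z : measurableType _ := (Y * measurableTypeR R)%type.
have mg : measurable_fun setT
    (fun q : Z * n.-tuple R => (q.1.1, [the n.+1.-tuple R of q.1.2 :: q.2])).
  apply: measurable_fun_pair; first exact: measurableT_comp.
  by apply: measurable_cons => //; exact: measurableT_comp.
apply: (@measurable_integral_section _ _ Y (measurableTypeR R) R
  (lebesgue_stieltjes_measure (F ord0)) `]-oo, x ord0]
  (fun p => iterated_integral (fun i => F (lift ord0 i))
    (fun i => x (lift ord0 i)) (fun s : n.-tuple R => f p.1 [tuple of p.2 :: s]))) => //.
apply: (IH _ Z _ _ (fun p (s : n.-tuple R) => f p.1 [tuple of p.2 :: s])).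
exact: (measurableT_comp mf mg).
Qed.

Lemma orthant_cons (R : realType) (n : nat) (x : 'I_n.+1 -> R) (a : R)
    (s : n.-tuple R) :
  orthant x [tuple of a :: s] <->
  a <= x ord0 /\ orthant (fun i => x (lift ord0 i)) s.
Proof.
split => [H|[ax sx] i].
  by split => [|i]; [have := H ord0 | have := H (lift ord0 i); rewrite tnthS].
case: (unliftP ord0 i) => [j|] ->; last by [].
by rewrite tnthS; exact: sx.
Qed.

Lemma measurable_cons_pair (R : realType) (n : nat) :
  measurable_fun setT
    (fun p : measurableTypeR R * n.-tuple R => [the n.+1.-tuple R of p.1 :: p.2]).
Proof. by apply: measurable_cons. Qed.

Section iterated_integral.
Context (R : realType).

(** [mu] is the product of the Stieltjes measures, built by induction: a Dirac mass on the empty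
    tuple, then the image of [lam \x mu'] under [c], with Tonelli for the integrals. Nonnegativity
    of [f] is asked only almost everywhere because [1 + U_n] is known to be nonnegative only almost
    surely. *)
Lemma iterated_integral_probability (n : nat)
    (F : 'I_n -> cumulativeBounded (0 : R) (1 : R)) :
  exists mu : probability (n.-tuple R) R,
    forall (x : 'I_n -> R) (f : n.-tuple R -> R),
    measurable_fun setT f -> {ae mu, forall t, 0 <= f t} ->
    iterated_integral F x f = (\int[mu]_(t in orthant x) (f t)%:E)%E.
Proof.
elim: n F => [|n IH] F.
  exists (\d_([tuple] : 0.-tuple R)) => x f mf _.
  rewrite integral_dirac//; last 2 first.
  - exact: measurable_orthant.
  - by apply/measurable_EFinP; exact: measurable_funTS.
  by rewrite diracE mem_set ?mul1e//= => -[].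
have [mu' mu'E] := IH (fun i => F (lift ord0 i)).
pose lam : probability (measurableTypeR R) R := lebesgue_stieltjes_measure (F ord0).
pose c := mfun_of (@measurable_cons_pair R n).
pose mu := distribution (lam \x mu')%E c.
exists mu => x f mf f0.
(* Tonelli is applied to a function that is nonnegative everywhere; the positive part equals [f]
   almost everywhere. *)
pose fp t := Num.max (f t) 0.
have mfp : measurable_fun setT fp by apply: measurable_maxr => //.
have fp0 t : 0 <= fp t by rewrite le_max lexx orbT.
have ffp : {ae mu, forall t, f t = fp t}.
  by apply: filterS f0 => t /= f0t; rewrite /fp; apply/esym/max_idPl.
have ffp2 : {ae (lam \x mu')%E, forall p, f (c p) = fp (c p)}.
  have [N [mN N0 SN]] := ffp.
  exists (c @^-1` N); split => //.
    by rewrite -[X in measurable X]setTI; exact: (@measurable_cons_pair R n).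
  by move=> p /= np; exact: SN.
(* For almost every first coordinate, [f] and [fp] agree at almost every tail, so the induction
   hypothesis applies to that section of [f]. *)
have ffpx := ae_xsection ffp2.
rewrite (@ae_eq_integral _ _ _ mu _ (fun t => (fp t)%:E)); last 4 first.
- exact: measurable_orthant.
- by apply/measurable_EFinP; exact: measurable_funTS.
- by apply/measurable_EFinP; exact: measurable_funTS.
- by apply: filterS ffp => t /= -> _.
pose h := (EFin \o fp) \_ (orthant x).
have mh : measurable_fun setT h.
  apply/(measurable_restrictT (EFin \o fp)); first exact: measurable_orthant.
  by apply: measurable_funTS; exact/measurable_EFinP.
have h0 t : (0 <= h t)%E by rewrite /h patchE; case: ifPn => // _; rewrite lee_fin.
rewrite [RHS]integral_mkcond -/h.
transitivity (\int[(lam \x mu')%E]_p h (c p))%E; last first.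
  rewrite -[RHS]/(\int[pushforward _ c]_t h t)%E.
  by rewrite ge0_integral_pushforward//; exact: measurable_cons_pair.
have mhc : measurable_fun setT (h \o c).
  by apply: measurableT_comp; [exact: mh|exact: measurable_cons_pair].
rewrite (fubini_tonelli1 (m1 := lam) (m2 := mu') (h \o c) mhc (fun p => h0 (c p))).
have mfc : measurable_fun setT
    (fun p : measurableTypeR R * n.-tuple R => f [the n.+1.-tuple R of p.1 :: p.2]).
  exact: (measurableT_comp mf (@measurable_cons_pair R n)).
rewrite /= integral_mkcond; apply: ae_eq_integral => //.
- apply: (measurable_restrictT (T1 := measurableTypeR R) _ _).1 => //.
  apply: measurable_funTS.
  exact: (@measurable_iterated_integral R n _ (measurableTypeR R) _ _
    (fun a (s : n.-tuple R) => f [the n.+1.-tuple R of a :: s]) mfc).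
- exact: (measurable_fun_fubini_tonelli_F (m2 := mu') (h \o c) mhc (fun p => h0 (c p))).
apply: filterS ffpx => a fa _; rewrite patchE /fubini_F.
have cE (s : n.-tuple R) : c (a, s) \in orthant x =
    (a \in `]-oo, x ord0]%classic) && (s \in orthant (fun i => x (lift ord0 i))).
  by apply/idP/andP; rewrite !inE/= in_itv/= orthant_cons.
case: ifPn => ax; last first.
  by rewrite integral0_eq// => s _; rewrite -[LHS]/(h (c (a, s))) /h patchE cE (negbTE ax).
have mfa : measurable_fun setT (fun s : n.-tuple R => f [the n.+1.-tuple R of a :: s]).
  exact: (@measurable_fun_pair2 _ _ _ (measurableTypeR R) _ _ _ a mfc).
have mfpa : measurable_fun setT (fun s : n.-tuple R => fp [the n.+1.-tuple R of a :: s]).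
  by apply: measurable_maxr.
rewrite mu'E//; last by apply: filterS fa => s /= ->.
rewrite (@ae_eq_integral _ _ _ mu' _ (fun s => (fp (c (a, s)))%:E)); last 4 first.
- exact: measurable_orthant.
- by apply/measurable_EFinP; exact: measurable_funTS.
- by apply/measurable_EFinP; exact: measurable_funTS.
- by apply: filterS fa => t /= -> _.
rewrite integral_mkcond; apply: eq_integral => s _.
by rewrite -[RHS]/(h (c (a, s))) /h !patchE cE ax.
Qed.
End iterated_integral.

(** * Image measures, densities and product integrals *)

Lemma integral_pushforwardT d1 d2 (T1 : measurableType d1)
    (T2 : measurableType d2) (R : realType) (phi : T1 -> T2)
    (mu : {measure set T1 -> \bar R}) (f : T2 -> \bar R) :
  measurable_fun setT phi -> measurable_fun setT f ->
  (\int[pushforward mu phi]_y f y = \int[mu]_x f (phi x))%E.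
Proof.
move=> mphi mf; rewrite [LHS]integralE [RHS]integralE.
congr (_ - _)%E.
  rewrite (ge0_integral_pushforward mphi mu measurableT (measurable_funepos mf)).
    by apply: eq_integral => x _ /=; rewrite !funeposE.
  by move=> y _; exact: funepos_ge0.
rewrite (ge0_integral_pushforward mphi mu measurableT (measurable_funeneg mf)).
  by apply: eq_integral => x _ /=; rewrite !funenegE.
by move=> y _; exact: funeneg_ge0.
Qed.

(** A difference of the integrals of [f^\+] and [f^\-] is finite only when both are. Any equality
    between an integral and a real number thus yields integrability. *)
Lemma integral_fin_num_integrable d (T : measurableType d) (R : realType)
    (mu : {measure set T -> \bar R}) (f : T -> \bar R) :
  measurable_fun setT f -> (\int[mu]_x f x)%E \is a fin_num ->
  mu.-integrable setT f.
Proof.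
move=> mf; rewrite integralE fin_numB => /andP[fp fn].
apply/integrableP; split => //.
rewrite (eq_integral (fun x => f^\+ x + f^\- x)%E); last first.
  by move=> x _; rewrite -/((abse \o f) x) fune_abse.
rewrite ge0_integralD//; last 2 first.
- exact: measurable_funepos.
- exact: measurable_funeneg.
by rewrite lte_add_pinfty// ltey_eq ?fp ?fn.
Qed.

Section density.
Context d (T : measurableType d) (R : realType).
Variables (mu nu : probability T R) (D : T -> R).
Hypotheses (mD : measurable_fun setT D) (D0 : forall x, 0 <= D x).
Hypothesis nuE : forall A, measurable A -> (nu A = \int[mu]_(x in A) (D x)%:E)%E.

Let mDE : measurable_fun setT (EFin \o D).
Proof. exact/measurable_EFinP. Qed.

Let numu : nu `<< mu.
Proof.
apply/null_content_dominatesP => A mA A0; rewrite nuE//.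
by apply: null_set_integral => //; exact: measurable_funTS.
Qed.

(** [D] and the Radon-Nikodym derivative of [nu] have equal integrals over every measurable set,
    hence agree almost everywhere. *)
Let ge0_integral_density (h : T -> \bar R) : measurable_fun setT h ->
  (forall x, 0 <= h x)%E -> (\int[nu]_x h x = \int[mu]_x (h x * (D x)%:E))%E.
Proof.
move=> mh h0; rewrite -(Radon_Nikodym_SigmaFinite.change_of_variables numu)//.
have fi := Radon_Nikodym_SigmaFinite.f_integrable numu.
apply: ae_eq_integral => //.
- by apply: emeasurable_funM => //; exact: measurable_int fi.
- exact: emeasurable_funM.
- apply: ae_eqe_mul2l; apply: integral_ae_eq => // E _ mE.
  by rewrite -nuE// -Radon_Nikodym_SigmaFinite.f_integral.
Qed.

(** As [D >= 0], multiplication by [D] commutes with positive and negative parts, which reduces the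
    formula to nonnegative functions. *)
Lemma integral_density (h : T -> R) : measurable_fun setT h ->
  (\int[nu]_x (h x)%:E = \int[mu]_x (h x * D x)%:E)%E.
Proof.
move=> mh; have mhE : measurable_fun setT (EFin \o h) by exact/measurable_EFinP.
rewrite [LHS]integralE [RHS]integralE.
rewrite !ge0_integral_density//; last 2 first.
- exact: measurable_funeneg.
- exact: measurable_funepos.
congr (_ - _)%E; apply: eq_integral => x _ /=.
  rewrite !funeposE -!EFin_max -EFinM; congr EFin.
  by rewrite maxr_pMl// mul0r.
rewrite !funenegE -!EFinN -!EFin_max -EFinM; congr EFin.
by rewrite maxr_pMl// mul0r mulNr.
Qed.
End density.

Lemma integrable_mul_prod d1 d2 (T1 : measurableType d1)
    (T2 : measurableType d2) (R : realType)
    (m1 : probability T1 R) (m2 : probability T2 R) (u : T1 -> R) (v : T2 -> R) :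
  m1.-integrable setT (EFin \o u) -> m2.-integrable setT (EFin \o v) ->
  (m1 \x m2)%E.-integrable setT (fun p => (u p.1 * v p.2)%:E) /\
  (\int[m1 \x m2]_p (u p.1 * v p.2)%:E =
     \int[m1]_x (u x)%:E * \int[m2]_y (v y)%:E)%E.
Proof.
move=> iu iv.
have /measurable_EFinP mu := measurable_int _ iu.
have /measurable_EFinP mv := measurable_int _ iv.
have muv : measurable_fun setT (fun p : T1 * T2 => (u p.1 * v p.2)%:E).
  by apply/measurable_EFinP; apply: measurable_funM; exact: measurableT_comp.
have iuv : (m1 \x m2)%E.-integrable setT (fun p => (u p.1 * v p.2)%:E).
  apply/(integrable12ltyP _ _ muv).
  under eq_integral => x _.
    under eq_integral => y _ do rewrite /= normrM EFinM.
    rewrite ge0_integralZl//; last first.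
      by do 2 apply: measurableT_comp => //.
    over.
  rewrite ge0_integralZr//; last 2 first.
  - by apply: measurableT_comp => //; exact: measurableT_comp.
  - by apply: integral_ge0.
  move/integrableP : iu => [_ iu]; move/integrableP : iv => [_ iv].
  by rewrite lte_mul_pinfty// ?integral_ge0// ge0_fin_numE// integral_ge0.
split => //; rewrite -(integral12_prod_meas1 iuv) /fubini_F.
rewrite (eq_integral (fun x => (u x)%:E * \int[m2]_y (v y)%:E)%E); last first.
  by move=> x _; rewrite -(integralZl measurableT iv); apply: eq_integral.
rewrite -(fineK (integrable_fin_num measurableT iv)).
by rewrite (integralZr measurableT iu).
Qed.

(** * Independence as invariance under mixing *)

Section mix.
Context (R : realType) (n : nat).

Definition mix (A : {set 'I_n}) (p : n.-tuple R * n.-tuple R) : n.-tuple R :=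
  [tuple if i \in A then tnth p.1 i else tnth p.2 i | i < n].

Lemma tnth_mix A p i :
  tnth (mix A p) i = if i \in A then tnth p.1 i else tnth p.2 i.
Proof. by rewrite tnth_mktuple. Qed.

Lemma measurable_mix A : measurable_fun setT (mix A).
Proof.
apply/measurable_fun_tnthP => i.
rewrite (_ : _ \o _ = if i \in A then (fun p : n.-tuple R * n.-tuple R => tnth p.1 i)
                      else (fun p => tnth p.2 i)); last first.
  by apply/funext => p; rewrite /= tnth_mix; case: ifP.
by case: ifP => _; apply: (measurableT_comp (@measurable_tnth _ _ _ i)).
Qed.

(** An orthant constraint on the coordinates in [A] only. The hypothesis [mu_cylinder] below states
    independence through these sets, [G] giving the marginal cdfs. *)
Definition cylinder (A : {set 'I_n}) (x : 'I_n -> R) : set (n.-tuple R) :=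
  [set t | forall i, i \in A -> tnth t i <= x i].

Lemma measurable_cylinder A x : measurable (cylinder A x).
Proof.
rewrite (_ : cylinder A x =
    \bigcap_(i in [set` A]) ((@tnth n R ^~ i) @^-1` `]-oo, x i])).
  apply: fin_bigcap_measurable => [|i _]; first exact: finite_finset.
  by rewrite -[X in measurable X]setTI; exact: measurable_tnth.
by apply/seteqP; split => t H i Ai; have := H i Ai; rewrite /= in_itv.
Qed.

Lemma orthant_cylinder (x : 'I_n -> R) : orthant x = cylinder [set: 'I_n]%SET x.
Proof. by apply/seteqP; split => t H i => [_|]; [exact: H|apply: H; rewrite inE]. Qed.

Variables (mu : probability (n.-tuple R) R) (G : 'I_n -> R -> \bar R).
Hypothesis mu_cylinder : forall A x, mu (cylinder A x) = (\prod_(i in A) G i (x i))%E.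

(** The preimage of an orthant is a rectangle of two cylinders, over [A] and over its complement.
    Its measure is the product over all coordinates, and orthants determine the measure. *)
Lemma mix_preserves A B : measurable B -> (mu \x mu)%E (mix A @^-1` B) = mu B.
Proof.
pose nu := distribution (mu \x mu)%E (mfun_of (measurable_mix A)).
move=> mB; apply/esym; rewrite -[RHS]/(nu B).
apply: orthant_unique mB => x; last first.
  by rewrite ltey_eq fin_num_measure//; exact: measurable_orthant.
rewrite -[RHS]/((mu \x mu)%E (mix A @^-1` orthant x)).
rewrite (_ : mix A @^-1` orthant x = cylinder A x `*` cylinder (~: A) x); last first.
  apply/seteqP; split => [[s t] H|[s t] [/= Hs Ht] i].
    split => i iA; have := H i; rewrite tnth_mix.
      by rewrite iA.
    by move: iA; rewrite inE => /negbTE ->.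
  by rewrite tnth_mix; case: ifPn => iA; [exact: Hs|apply: Ht; rewrite inE].
rewrite product_measure1E; [|exact: measurable_cylinder..].
rewrite orthant_cylinder; apply: (etrans (mu_cylinder _ _)).
apply/esym; apply: (etrans (congr2 mule (mu_cylinder _ _) (mu_cylinder _ _))).
apply/esym; rewrite (bigID (mem A))/=; congr (_ * _)%E; apply: eq_bigl => i.
  by rewrite inE.
by rewrite !inE.
Qed.

Lemma integral_mix A f : measurable_fun setT f ->
  (\int[mu]_t f t = \int[mu \x mu]_p f (mix A p))%E.
Proof.
move=> mf; rewrite -(integral_pushforwardT _ (measurable_mix A) mf).
apply: (eq_measure_integral (distribution (mu \x mu)%E (mfun_of (measurable_mix A)))).
by move=> B mB _; rewrite -[RHS]/((mu \x mu)%E (mix A @^-1` B)) mix_preserves.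
Qed.

Lemma integrable_mix A f : measurable_fun setT f ->
  mu.-integrable setT f <-> (mu \x mu)%E.-integrable setT (f \o mix A).
Proof.
move=> mf; have mfm : measurable_fun setT (f \o mix A).
  exact: (measurableT_comp mf (measurable_mix A)).
have mabs : measurable_fun setT (abse \o f) by exact: measurableT_comp.
have E := integral_mix A mabs.
by split => /integrableP[_ H]; apply/integrableP; split => //; move: H; rewrite E.
Qed.

(** The two invariances say that [u] depends on the coordinates in [A] only and [v] on the others
    only. Composition with [mix A] separates the variables. *)
Lemma integrable_mul_mix (A : {set 'I_n}) (u v : n.-tuple R -> R) :
  (forall p, u (mix A p) = u p.1) -> (forall p, v (mix A p) = v p.2) ->
  mu.-integrable setT (EFin \o u) -> mu.-integrable setT (EFin \o v) ->
  mu.-integrable setT (fun t => (u t * v t)%:E) /\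
  (\int[mu]_t (u t * v t)%:E = \int[mu]_t (u t)%:E * \int[mu]_t (v t)%:E)%E.
Proof.
move=> uA vA iu iv; have [iuv Euv] := integrable_mul_prod iu iv.
have muv : measurable_fun setT (fun t => (u t * v t)%:E).
  apply/measurable_EFinP; apply: measurable_funM.
    by apply/measurable_EFinP; exact: measurable_int iu.
  by apply/measurable_EFinP; exact: measurable_int iv.
have E : (fun t => (u t * v t)%:E) \o mix A = (fun p => (u p.1 * v p.2)%:E).
  by apply/funext => p /=; rewrite uA vA.
split; first by apply/(integrable_mix A muv); rewrite E.
rewrite -Euv (integral_mix A muv); apply: eq_integral => p _.
by rewrite uA vA.
Qed.
End mix.

(** * Canonical functions and moments on the product space *)

Section canonical.
Context (R : realType) (n : nat) (mu : probability (n.-tuple R) R).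
Variables (G : 'I_n -> R -> \bar R) (gam : {set 'I_n} -> n.-tuple R -> R).

(** Invariance under [agree A] expresses dependence on the coordinates in [A] alone, for functions
    and for sets. *)
Definition agree (A : {set 'I_n}) (s t : n.-tuple R) :=
  forall i, i \in A -> tnth s i = tnth t i.

Hypothesis mu_cylinder : forall A x, mu (cylinder A x) = (\prod_(i in A) G i (x i))%E.
Hypothesis gam_agree : forall A s t, agree A s t -> gam A s = gam A t.
Hypothesis gam_integrable : forall A, mu.-integrable setT (EFin \o gam A).
Hypothesis gam_integral0 : forall (A : {set 'I_n}) k, k \in A ->
  forall C, measurable C ->
  (forall s t, agree (A :\ k) s t -> C s -> C t) ->
  (\int[mu]_(t in C) (gam A t)%:E = 0)%E.

Let mgam A : measurable_fun setT (EFin \o gam A).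
Proof. exact: measurable_int (gam_integrable A). Qed.

Let gam_mix_integrable A B :
  (mu \x mu)%E.-integrable setT (EFin \o gam B \o mix A).
Proof.
by apply/(integrable_mix mu_cylinder A (mgam B)); exact: gam_integrable.
Qed.

(* the conditional expectation of [gam B] given the coordinates in [A] *)
Definition cond_gam (A B : {set 'I_n}) (s : n.-tuple R) : \bar R :=
  (\int[mu]_t (gam B (mix A (s, t)))%:E)%E.

Lemma cond_gam_subset (A B : {set 'I_n}) s : B \subset A ->
  cond_gam A B s = (gam B s)%:E.
Proof.
move=> /fintype.subsetP BA; rewrite /cond_gam (eq_integral (fun=> (gam B s)%:E)).
  by rewrite integral_cst//= (congr1 (mule _) (probability_setT mu)) mule1.
move=> t _; congr EFin; apply: gam_agree => i iB.
by rewrite tnth_mix BA.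
Qed.

Lemma cond_gam_integrable A B : mu.-integrable setT (cond_gam A B).
Proof. exact: integrable_fubini_F (gam_mix_integrable A B). Qed.

(* The positivity set of [cond_gam A B] depends only on the coordinates in
   [B :&: A], hence in [B :\ k] for some [k], so (A2) applies to it. *)
Lemma cond_gam_eq0 (A B : {set 'I_n}) : ~~ (B \subset A) ->
  ae_eq mu setT (cond_gam A B) (cst 0%E).
Proof.
move=> /fintype.subsetPn[k kB kA].
have cond_agree (D : {set 'I_n}) (s t : n.-tuple R) : B :&: A \subset D -> agree D s t ->
    cond_gam A B s = cond_gam A B t.
  move=> /fintype.subsetP BAD st; apply: eq_integral => u _; congr EFin.
  apply: gam_agree => i iB; rewrite !tnth_mix; case: ifP => // iA.
  by apply/st/BAD; rewrite inE iB.
have mcond := measurable_int _ (cond_gam_integrable A B).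
(* By Fubini through [mix A], this integral equals that of [gam B] over the same set, which
   vanishes. *)
have int0 (C : set (\bar R)) : measurable C ->
    (\int[mu]_(s in cond_gam A B @^-1` C) cond_gam A B s = 0)%E.
  move=> mC; set D := _ @^-1` C.
  have mD : measurable D by rewrite -[X in measurable X]setTI; exact: mcond.
  have D0 : (\int[mu]_(t in D) (gam B t)%:E = 0)%E.
    apply: (gam_integral0 kB mD) => s t st; rewrite /D/=.
    rewrite (cond_agree (B :\ k) s t)//; apply/fintype.subsetP => i.
    by rewrite !inE => /andP[-> iA]; rewrite andbT; apply: contraNneq kA => <-.
  have mgD : measurable_fun setT ((EFin \o gam B) \_ D).
    by apply: (measurable_restrictT _ _).1 => //; apply: measurable_funTS; exact: mgam.
  have igD : mu.-integrable setT ((EFin \o gam B) \_ D).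
    apply/(integrable_mkcond _ mD).
    exact: (integrableS measurableT mD (@subsetT _ _) (gam_integrable B)).
  rewrite -[RHS]D0 [RHS]integral_mkcond (integral_mix mu_cylinder A mgD).
  rewrite -integral12_prod_meas1; last exact/(integrable_mix mu_cylinder A mgD).
  rewrite integral_mkcond; apply: eq_integral => s _.
  (* Mixing keeps the coordinates in [A], the only ones on which [D] depends. *)
  have DE t : (mix A (s, t) \in D) = (s \in D).
    rewrite /D; apply/idP/idP; rewrite !inE/= (cond_agree A _ s) ?subsetIr//.
      by move=> i iA; rewrite tnth_mix iA.
    by move=> i iA; rewrite tnth_mix iA.
  rewrite patchE /fubini_F; case: ifPn => sD.
    by apply: eq_integral => t _; rewrite patchE DE sD.
  by rewrite integral0_eq// => t _; rewrite patchE DE (negbTE sD).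
apply/(ae_eq_integral_abs mu measurableT mcond).
rewrite (eq_integral (fun x => (cond_gam A B)^\+ x + (cond_gam A B)^\- x)%E); last first.
  by move=> x _; rewrite -/((abse \o cond_gam A B) x) fune_abse.
rewrite ge0_integralD//; last 2 first.
- exact: measurable_funepos.
- exact: measurable_funeneg.
(* The positive part has the integral over the positivity set, which is zero; the total integral is
   zero too, hence so is that of the negative part. *)
have P0 : (\int[mu]_s (cond_gam A B)^\+ s = 0)%E.
  rewrite -(int0 `]0%E, +oo[%classic); last exact: emeasurable_itv.
  rewrite [RHS]integral_mkcond; apply: eq_integral => s _.
  rewrite patchE funeposE; case: ifPn => [/set_mem|/negP sD].
    by rewrite /= in_itv/= andbT => /ltW/max_idPl.
  apply/max_idPr; rewrite leNgt; apply/negP => s0; apply: sD; apply/mem_set.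
  by rewrite /= in_itv/= s0.
have I0 : (\int[mu]_s cond_gam A B s = 0)%E := int0 _ measurableT.
move: I0; rewrite (integralE mu setT (cond_gam A B)) P0.
by rewrite add0e => /eqP; rewrite oppe_eq0 => /eqP ->; rewrite adde0.
Qed.

(** * Mixed moments on the product space *)

Definition monomial (A : {set 'I_n}) (a : 'I_n -> nat) (t : n.-tuple R) : R :=
  \prod_(i in A) tnth t i ^+ a i.

Lemma measurable_monomial A a : measurable_fun setT (monomial A a).
Proof.
rewrite (_ : monomial A a =
    fun t => \prod_(i <- enum A) tnth t i ^+ a i).
  by apply: measurable_prod => i _; apply: measurable_funX; exact: measurable_tnth.
by apply/funext => t; rewrite /monomial big_enum.
Qed.

Variable alpha : nat.
Hypothesis power_integrable : forall i k, (k <= alpha)%N ->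
  mu.-integrable setT (fun t => (tnth t i ^+ k)%:E).

(** Coordinates are split off one at a time by independence of [tnth t k] and the others. *)
Lemma integral_monomial A a : (forall j, a j <= alpha)%N ->
  mu.-integrable setT (fun t => (monomial A a t)%:E) /\
  (\int[mu]_t (monomial A a t)%:E =
     \prod_(i in A) \int[mu]_t (tnth t i ^+ a i)%:E)%E.
Proof.
move=> aa; have [m] := ubnP #|A|; elim: m A => // m IH A Am.
have [->|/set0Pn[k kA]] := eqVneq A finset.set0.
  have M1 t : monomial finset.set0 a t = 1 by rewrite /monomial big_set0.
  split.
    rewrite (_ : (fun t => _) = EFin \o cst 1).
      exact: finite_measure_integrable_cst.
    by apply/funext => t; rewrite M1.
  rewrite big_set0 (eq_integral (cst 1%E)); last by move=> t _; rewrite M1.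
  by rewrite integral_cst// mul1e; exact: probability_setT.
have [iA EA] : mu.-integrable setT (fun t => (monomial (A :\ k) a t)%:E) /\
    (\int[mu]_t (monomial (A :\ k) a t)%:E =
     \prod_(i in A :\ k) \int[mu]_t (tnth t i ^+ a i)%:E)%E.
  by apply: IH; move: Am; rewrite (cardsD1 k) kA.
rewrite (big_setD1 k)//= -EA.
have -> : (fun t => (monomial A a t)%:E) =
    (fun t => (tnth t k ^+ a k * monomial (A :\ k) a t)%:E).
  by apply/funext => t; rewrite /monomial (big_setD1 k).
apply: (integrable_mul_mix mu_cylinder (A := [set k]%SET)) => //.
- by move=> p; rewrite tnth_mix inE eqxx.
- move=> p; apply: eq_bigr => i; rewrite !inE => /andP[/negbTE ik _].
  by rewrite tnth_mix inE ik.
- exact: power_integrable.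
Qed.

(** The monomial over [A] is the one over [B] times the one over [A :\: B]; the latter is
    independent of [gam B] times the former, whose integral is zero. *)
Lemma integral_monomial_gam (A B : {set 'I_n}) a : (forall j, a j <= alpha)%N ->
  B \subset A -> (\int[mu]_t (monomial B a t * gam B t)%:E = 0)%E ->
  mu.-integrable setT (fun t => (monomial A a t * gam B t)%:E) /\
  (\int[mu]_t (monomial A a t * gam B t)%:E = 0)%E.
Proof.
move=> aa BA int0.
have -> : (fun t => (monomial A a t * gam B t)%:E) =
    (fun t => ((monomial B a t * gam B t) * monomial (A :\: B) a t)%:E).
  apply/funext => t; rewrite /monomial (big_setID B)/= (finset.setIidPr BA).
  by rewrite mulrAC.
have [iM _] := integral_monomial (A :\: B) aa.
rewrite -(mul0e (\int[mu]_t (monomial (A :\: B) a t)%:E)%E) -int0.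
apply: (integrable_mul_mix mu_cylinder (A := B)) => //.
- move=> p; congr (_ * _).
    by apply: eq_bigr => i iB; rewrite tnth_mix iB.
  by apply: gam_agree => i iB; rewrite tnth_mix iB.
- move=> p; apply: eq_bigr => i; rewrite !inE => /andP[/negbTE iB _].
  by rewrite tnth_mix iB.
(* The finite value in [int0] supplies the integrability of this factor. *)
- apply: integral_fin_num_integrable; last by rewrite int0.
  apply/measurable_EFinP; apply: measurable_funM.
    exact: measurable_monomial.
  exact/measurable_EFinP.
Qed.

Lemma moment_of_gam a : (forall j, a j <= alpha)%N ->
  (forall A, \int[mu]_t (monomial A a t * gam A t)%:E = 0)%E ->
  (\int[mu]_t (monomial [set: 'I_n]%SET a t * (1 + \sum_A gam A t))%:E =
   \prod_i \int[mu]_t (tnth t i ^+ a i)%:E)%E.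
Proof.
move=> aa H; have [iM EM] := integral_monomial [set: 'I_n]%SET aa.
have Hg B := integral_monomial_gam aa (finset.subsetT B) (H B).
transitivity (\int[mu]_t ((monomial [set: 'I_n]%SET a t)%:E +
    \sum_(A : {set 'I_n}) (monomial [set: 'I_n]%SET a t * gam A t)%:E))%E.
  apply: eq_integral => t _; rewrite mulrDr mulr1 mulr_sumr EFinD; congr (_ + _)%E.
  by rewrite -sumEFin.
rewrite integralD//; last by apply: integrable_sum => // A _; exact: (Hg A).1.
rewrite integral_sum//; last by move=> A; exact: (Hg A).1.
rewrite big1 ?adde0; last by move=> A _; exact: (Hg A).2.
by rewrite EM; apply: eq_bigl => i; rewrite inE.
Qed.

Lemma gam_of_moment :
  (forall a, (forall j, a j <= alpha)%N ->
    (\int[mu]_t (monomial [set: 'I_n]%SET a t * (1 + \sum_A gam A t))%:E =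
     \prod_i \int[mu]_t (tnth t i ^+ a i)%:E)%E) ->
  forall A a, (forall j, a j <= alpha)%N ->
  (\int[mu]_t (monomial A a t * gam A t)%:E = 0)%E.
Proof.
move=> H A; have [m] := ubnP #|A|; elim: m A => // m IH A Am a aa.
pose M := monomial A a; pose U t := \sum_B gam B t.
have [iM _] := integral_monomial A aa.
have mM : measurable_fun setT M by exact: measurable_monomial.
have mg B : measurable_fun setT (gam B) by exact/measurable_EFinP.
have mU : measurable_fun setT U by exact: measurable_sum.
(* Exponent zero off [A] turns the full monomial into [M]. *)
pose a' i := if i \in A then a i else 0%N.
have ME : monomial [set: 'I_n]%SET a' = M.
  apply/funext => t; rewrite /M /monomial [RHS]big_mkcond/=.
  by apply: eq_big => [i|i _]; rewrite ?inE// /a'; case: ifP.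
have EMU : (\int[mu]_t (M t * (1 + U t))%:E = \int[mu]_t (M t)%:E)%E.
  have aa' j : (a' j <= alpha)%N by rewrite /a'; case: ifP.
  rewrite -ME H// (integral_monomial _ aa').2.
  by apply: eq_bigl => i; rewrite inE.
have iMU1 : mu.-integrable setT (fun t => (M t * (1 + U t))%:E).
  apply: integral_fin_num_integrable.
    by apply/measurable_EFinP; apply: measurable_funM => //; exact: measurable_funD.
  by rewrite EMU; exact: integrable_fin_num.
have MUE : (fun t => (M t * U t)%:E) = (fun t => (M t * (1 + U t))%:E - (M t)%:E)%E.
  by apply/funext => t; rewrite -EFinB mulrDr mulr1 addrAC subrr add0r.
have iMU : mu.-integrable setT (fun t => (M t * U t)%:E).
  by rewrite MUE; exact: integrableB.
have EMU0 : (\int[mu]_t (M t * U t)%:E = 0)%E.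
  rewrite MUE integralB_EFin// EMU subee//; exact: integrable_fin_num.
have mMU := measurable_int _ iMU.
have imMU := (integrable_mix mu_cylinder A mMU).1 iMU.
(* [C] is the conditional expectation of [M * U] given the coordinates in [A]; [S] is what remains
   of it once the terms with [B] not contained in [A] vanish. *)
pose C := fubini_F mu ((fun t => (M t * U t)%:E) \o mix A).
have iC : mu.-integrable setT C by exact: integrable_fubini_F imMU.
have EC : (\int[mu]_s C s = 0)%E.
  by rewrite integral12_prod_meas1// -(integral_mix mu_cylinder A mMU).
pose S s := (M s * \sum_(B : {set 'I_n} | B \subset A) gam B s)%:E.
have mS : measurable_fun setT S.
  apply/measurable_EFinP; apply: measurable_funM => //.
  by under eq_fun do rewrite big_mkcond; apply: measurable_sum => B; case: (B \subset A).
have CS : ae_eq mu setT C S.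
  (* There are finitely many [B], so one null set of [s] serves for all; off it, sum and integral
     can be exchanged. *)
  have H1 : {ae mu, forall s (B : {set 'I_n}),
      mu.-integrable setT (fun t => (gam B (mix A (s, t)))%:E)}.
    by apply: filter_forall => B; exact: ae_integrable1 (gam_mix_integrable A B).
  have H2 : {ae mu, forall s (B : {set 'I_n}),
      ~~ (B \subset A) -> cond_gam A B s = 0%E}.
    apply: filter_forall => B; have [BA|nBA] := boolP (B \subset A).
      exact: aeW.
    by apply: filterS (cond_gam_eq0 nBA) => s /= h _; exact: h.
  apply: filterS2 H1 H2 => s ig c0 _.
  rewrite /C /fubini_F /=.
  transitivity (\int[mu]_t ((M s)%:E * \sum_(B : {set 'I_n}) (gam B (mix A (s, t)))%:E))%E.
    apply: eq_integral => t _; rewrite sumEFin -EFinM; congr (EFin (_ * _)).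
    by apply: eq_bigr => i iA; rewrite tnth_mix iA.
  rewrite integralZl//; last by apply: integrable_sum => // B _; exact: ig.
  rewrite integral_sum// /S EFinM -sumEFin; congr (_ * _)%E.
  rewrite [RHS]big_mkcond; apply: eq_bigr => B _.
  rewrite -[LHS]/(cond_gam A B s); case: ifPn => BA; last exact: c0.
  exact: cond_gam_subset.
have ES : (\int[mu]_s S s = 0)%E.
  by rewrite -EC; apply/esym; apply: ae_eq_integral => //; exact: measurable_int iC.
have iS : mu.-integrable setT S.
  by apply: integral_fin_num_integrable => //; rewrite ES.
have HB (B : {set 'I_n}) : B \proper A ->
    mu.-integrable setT (fun t => (M t * gam B t)%:E) /\
    (\int[mu]_t (M t * gam B t)%:E = 0)%E.
  move=> BA; apply: integral_monomial_gam => //; first exact: proper_sub.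
  apply: IH => //; exact: leq_trans (proper_card BA) _.
(* The term [B = A] of [S] is isolated; the proper subsets contribute zero by [HB]. *)
have gE : (fun t => (M t * gam A t)%:E) =
    (fun t => S t - \sum_(B : {set 'I_n} | B \proper A) (M t * gam B t)%:E)%E.
  apply/funext => t; rewrite sumEFin -EFinB /S (bigD1 A)//= mulrDr mulr_sumr.
  congr EFin; rewrite -[LHS]addr0 -addrA; congr (_ + _).
  apply/esym/eqP; rewrite subr_eq0; apply/eqP; apply: eq_bigl => B.
  by rewrite finset.properEneq andbC.
rewrite -/M gE integralB//; last first.
  by apply: integrable_sum => // B /HB[].
rewrite ES (_ : (fun x => _) =
    fun t => (\sum_(B : {set 'I_n})
      (if B \proper A then M t * gam B t else 0)%:E)%E); last first.
  by apply/funext => t; rewrite big_mkcond; apply: eq_bigr => B _; case: ifP.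
rewrite integral_sum//; last first.
  move=> B; case: (boolP (B \proper A)) => BA; first exact: (HB _ BA).1.
  exact: integrable0.
rewrite big1 ?sube0// => B _; case: (boolP (B \proper A)) => BA.
  exact: (HB _ BA).2.
by rewrite integral0.
Qed.
End canonical.

(** * Laws of random vectors *)

Section density_measure.
Context d (T : measurableType d) (R : realType) (mu : {measure set T -> \bar R}).
Variable D : T -> R.
Hypotheses (mD : measurable_fun setT D) (D0 : forall x, 0 <= D x).

(** Given a measure structure below, so that [orthant_unique] can compare it with the law of a
    random vector. *)
Definition density_measure (A : set T) : \bar R := (\int[mu]_(x in A) (D x)%:E)%E.

Let density_measure0 : density_measure set0 = 0%E.
Proof. exact: integral_set0. Qed.

Let density_measure_ge0 A : (0 <= density_measure A)%E.
Proof. by apply: integral_ge0 => x _; rewrite lee_fin. Qed.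

Let density_measure_sigma_additive : semi_sigma_additive density_measure.
Proof.
move=> F mF tF mUF; rewrite /density_measure ge0_integral_bigcup//; last 2 first.
- by apply: measurable_funTS; exact/measurable_EFinP.
- by move=> x _; rewrite lee_fin.
by apply: is_cvg_nneseries => k _ _; exact: density_measure_ge0.
Qed.

HB.instance Definition _ := isMeasure.Build _ _ _ density_measure
  density_measure0 density_measure_ge0 density_measure_sigma_additive.

Lemma density_measure_ex : exists m : {measure set T -> \bar R},
  forall A, m A = (\int[mu]_(x in A) (D x)%:E)%E.
Proof. by exists density_measure. Qed.
End density_measure.

Section law.
Context (R : realType) d (T : measurableType d) (P : probability T R) (n : nat).
Variable X : 'I_n -> {RV P >-> R}.

Lemma measurable_random_vector : measurable_fun setT (random_vector X).
Proof.
apply/measurable_fun_tnthP => i.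
rewrite (_ : _ \o _ = X i); first exact: measurable_funP.
by apply/funext => w; rewrite /= tnth_mktuple.
Qed.

Definition law : set (n.-tuple R) -> \bar R :=
  distribution P (mfun_of measurable_random_vector).

HB.instance Definition _ := Probability.on law.

Lemma lawE A : law A = P (random_vector X @^-1` A).
Proof. by []. Qed.

Lemma integral_law (h : n.-tuple R -> \bar R) : measurable_fun setT h ->
  (\int[law]_t h t = \int[P]_w h (random_vector X w))%E.
Proof. move=> mh; exact: integral_pushforwardT measurable_random_vector mh. Qed.

Lemma integrable_law (h : n.-tuple R -> \bar R) : measurable_fun setT h ->
  law.-integrable setT h <-> P.-integrable setT (h \o random_vector X).
Proof.
move=> mh; have mhX : measurable_fun setT (h \o random_vector X).
  exact: measurableT_comp mh measurable_random_vector.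
have mabs : measurable_fun setT (abse \o h) by exact: measurableT_comp.
have E := integral_law mabs.
by split => /integrableP[_ H]; apply/integrableP; split => //; move: H; rewrite E.
Qed.

(** Measurability of [S] makes its complement itself the null set required on tuples. *)
Lemma ae_law (S : n.-tuple R -> Prop) : measurable [set t | S t] ->
  {ae P, forall w, S (random_vector X w)} -> {ae law, forall t, S t}.
Proof.
move=> mS [N [mN N0 SN]]; exists (~` [set t | S t]); split => //.
  exact: measurableC.
rewrite lawE; apply: (subset_measure0 _ _ _ N0) => //.
by rewrite -[X in measurable X]setTI; apply: measurable_random_vector => //; exact: measurableC.
Qed.

Lemma law_orthant x : law (orthant x) = joint_cdf X x.
Proof.
rewrite lawE /joint_cdf; congr (P _); apply/seteqP.
by split => w H i; have := H i; rewrite tnth_mktuple.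
Qed.
End law.

(** Seen as vectors of length one, the two variables have laws that agree on orthants, hence
    everywhere. *)
Lemma eq_cdf_integral (R : realType) d (T : measurableType d) (P : probability T R)
    d' (T' : measurableType d') (Q : probability T' R)
    (X : {RV P >-> R}) (Y : {RV Q >-> R}) (h : R -> R) :
  (forall x, cdf X x = cdf Y x) -> measurable_fun setT h ->
  (\int[P]_w (h (X w))%:E = \int[Q]_w (h (Y w))%:E)%E.
Proof.
move=> XY mh.
pose X1 (i : 'I_1) := X; pose Y1 (i : 'I_1) := Y.
have mht : measurable_fun setT (fun t : 1.-tuple R => (h (tnth t ord0))%:E).
  by apply/measurable_EFinP; apply: measurableT_comp => //; exact: measurable_tnth.
transitivity (\int[law X1]_t (h (tnth t ord0))%:E)%E.
  by rewrite integral_law//; apply: eq_integral => w _; rewrite tnth_mktuple.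
transitivity (\int[law Y1]_t (h (tnth t ord0))%:E)%E; last first.
  by rewrite integral_law//; apply: eq_integral => w _; rewrite tnth_mktuple.
apply: eq_measure_integral => A mA _; apply: orthant_unique mA => x; last first.
  by rewrite ltey_eq fin_num_measure//; exact: measurable_orthant.
transitivity (joint_cdf X1 x); first exact: law_orthant.
transitivity (joint_cdf Y1 x); last exact/esym/law_orthant.
rewrite /joint_cdf.
have E (S : Type) (Z : S -> R) : [set w | forall i : 'I_1, Z w <= x i] =
    Z @^-1` `]-oo, x ord0].
  by apply/seteqP; split => w /=; rewrite in_itv/= => H // i; rewrite ord1.
rewrite /X1 /Y1 !E; exact: XY.
Qed.

Lemma law_cylinder (R : realType) d (T : measurableType d) (P : probability T R)
    (n : nat) (X : 'I_n -> {RV P >-> R}) A x : mutually_independent X ->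
  law X (cylinder A x) = (\prod_(i in A) cdf (X i) (x i))%E.
Proof.
move=> /(_ A (fun i => `]-oo, x i]%classic)) H.
rewrite lawE -H//; congr (P _).
apply/seteqP; split => w Hw i iA.
  by have := Hw i iA; rewrite tnth_mktuple /= in_itv.
by have := Hw i iA; rewrite tnth_mktuple /= in_itv.
Qed.

Lemma iterated_integral1 (R : realType) (n : nat)
    (F : 'I_n -> cumulativeBounded (0 : R) (1 : R)) x :
  iterated_integral F x (fun=> 1) = (\prod_i (F i (x i))%:E)%E.
Proof.
elim: n F x => [|n IH] F x; first by rewrite big_ord0.
rewrite /= IH big_ord_recl integral_cst// muleC; congr (_ * _)%E.
exact: cdf_lebesgue_stieltjes_id.
Qed.

(** * Subvectors, generated sigma-algebras and the density of the joint law *)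

Section extend.
Context (R : realType) (n : nat) (A : {set 'I_n}).

(* a right inverse of [subvector A], padding with 0 *)
Definition extend (u : #|A|.-tuple R) : n.-tuple R :=
  [tuple if [pick k | enum_val k == i] is Some k then tnth u k else 0 | i < n].

Lemma measurable_extend : measurable_fun setT extend.
Proof.
apply/measurable_fun_tnthP => i.
rewrite (_ : _ \o _ = fun u : #|A|.-tuple R =>
    if [pick k : 'I_#|A| | enum_val k == i] is Some k then tnth u k else 0); last first.
  by apply/funext => u; rewrite /= tnth_mktuple.
by case: pickP => [k _|_]; [exact: measurable_tnth|exact: measurable_cst].
Qed.

Lemma agree_extend t : agree A (extend (subvector A t)) t.
Proof.
move=> i iA; rewrite tnth_mktuple; case: pickP => [k /eqP <-|/(_ (enum_rank_in iA i))].
  by rewrite tnth_mktuple.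
by rewrite enum_rankK_in// eqxx.
Qed.

Lemma measurable_subvector : measurable_fun setT (@subvector R n A).
Proof.
apply/measurable_fun_tnthP => k.
rewrite (_ : _ \o _ = fun t : n.-tuple R => tnth t (enum_val k)).
  exact: measurable_tnth.
by apply/funext => t; rewrite /= tnth_mktuple.
Qed.
End extend.

(** Membership in [C] can be read off the subvector: padding it by [extend] changes no coordinate in
    [A]. *)
Lemma sigma_generated_agree (R : realType) d (T : measurableType d)
    (P : probability T R) (n : nat) (X : 'I_n -> {RV P >-> R}) (A : {set 'I_n})
    (C : set (n.-tuple R)) : measurable C ->
  (forall s t, agree A s t -> C s -> C t) ->
  sigma_generated X A (random_vector X @^-1` C).
Proof.
move=> mC CA; rewrite /sigma_generated.
rewrite (_ : (fun k => _) = fun k : 'I_#|A| =>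
    (fun u : #|A|.-tuple R => tnth u k) \o (fun w => subvector A (random_vector X w))); last first.
  by apply/funext => k; apply/funext => w; rewrite /= !tnth_mktuple.
rewrite g_sigma_preimage_comp; exists (@extend R n A @^-1` C).
  rewrite -[X in g_sigma_preimage _ X]setTI; exact: measurable_extend.
rewrite setTI; apply/seteqP; split => w /=; apply: CA.
  exact: agree_extend.
by move=> i iA; rewrite agree_extend.
Qed.

Section canonical_law.
Context (R : realType) d (T : measurableType d) (Q : probability T R) (n : nat).
Variables (F : 'I_n -> cumulativeBounded (0 : R) (1 : R)) (xi : 'I_n -> {RV Q >-> R}).
Hypothesis xi_indep : mutually_independent xi.
Hypothesis xi_cdf : forall i x, cdf (xi i) x = (F i x)%:E.

(** For [f = 1] the iterated integral is the product of the marginal cdfs, so the measure [m]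
    representing iterated integrals agrees with the law of [xi] on orthants. *)
Lemma iterated_integral_law x (f : n.-tuple R -> R) :
  measurable_fun setT f -> {ae law xi, forall t, 0 <= f t} ->
  iterated_integral F x f = (\int[law xi]_(t in orthant x) (f t)%:E)%E.
Proof.
move=> mf [N [mN N0 SN]]; have [m mE] := iterated_integral_probability F.
have mxi A : measurable A -> m A = law xi A.
  move=> mA; apply: orthant_unique mA => y; last first.
    by rewrite ltey_eq fin_num_measure//; exact: measurable_orthant.
  have mo := measurable_orthant y.
  transitivity (\int[m]_(t in orthant y) (1 : R)%:E)%E.
    by rewrite integral_cst// mul1e.
  rewrite -(mE y (fun=> 1))//; last by apply: aeW => t; exact: ler01.
  rewrite iterated_integral1 orthant_cylinder.
  apply: (etrans _ (esym (law_cylinder _ _ xi_indep))).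
  by apply: eq_big => [i|i _]; rewrite ?inE// xi_cdf.
rewrite (mE x f mf); last by exists N; split => //; rewrite mxi.
by apply: eq_measure_integral => A mA _; exact: mxi.
Qed.

Variables (d' : measure_display) (T' : measurableType d') (P : probability T' R).
Variables (X : 'I_n -> {RV P >-> R}) (f : n.-tuple R -> R).
Hypothesis mf : measurable_fun setT f.
Hypothesis f_ge0 : {ae Q, forall w, 0 <= f (random_vector xi w)}.
Hypothesis X_density : forall x, joint_cdf X x = iterated_integral F x f.

(** The positive part [D] of [f] equals [f] almost surely, and the measure with density [D] agrees
    with the law of [X] on orthants. *)
Lemma integral_law_density (h : n.-tuple R -> R) : measurable_fun setT h ->
  (\int[law X]_t (h t)%:E = \int[law xi]_t (h t * f t)%:E)%E.
Proof.
move=> mh; pose D t := Num.max (f t) 0.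
have mD : measurable_fun setT D by exact: measurable_maxr.
have D0 t : 0 <= D t by rewrite le_max lexx orbT.
have f0 : {ae law xi, forall t, 0 <= f t}.
  apply: ae_law => //; rewrite -[X in measurable X]setTI.
  rewrite (_ : [set t | 0 <= f t] = f @^-1` `[0, +oo[%classic); first exact: mf.
  by apply/seteqP; split => t; rewrite /= in_itv/= andbT.
have Df : {ae law xi, forall t, D t = f t}.
  by apply: filterS f0 => t ft; apply/max_idPl.
have [m mE] := density_measure_ex (law xi) mD D0.
rewrite (@integral_density _ _ _ (law xi) (law X) D)//; last first.
  move=> A mA; rewrite -mE; apply: orthant_unique mA => x; last first.
    by rewrite ltey_eq fin_num_measure//; exact: measurable_orthant.
  apply: (etrans (law_orthant X x)).
  rewrite X_density (iterated_integral_law x mf f0) mE.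
  apply: ae_eq_integral.
  - exact: measurable_orthant.
  - by apply: measurable_funTS; exact/measurable_EFinP.
  - by apply: measurable_funTS; exact/measurable_EFinP.
  - by apply: filterS Df => t -> _.
apply: ae_eq_integral => //.
- by apply/measurable_EFinP; exact: measurable_funM.
- by apply/measurable_EFinP; exact: measurable_funM.
- by apply: filterS Df => t -> _.
Qed.
End canonical_law.

(** Domination by [1 + |X|^m]: compare with 1 where [|X| <= 1] and with [|X|^m] elsewhere. *)
Lemma integrable_power (R : realType) d (T : measurableType d)
    (P : probability T R) (X : T -> R) (k m : nat) : measurable_fun setT X ->
  (k <= m)%N -> (\int[P]_w (`|X w| ^+ m)%:E < +oo)%E ->
  P.-integrable setT (fun w => (X w ^+ k)%:E).
Proof.
move=> mX km moo.
have mabs : measurable_fun setT (fun w => `|X w| ^+ m).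
  by apply: measurable_funX; exact: measurableT_comp.
have im : P.-integrable setT (fun w => (`|X w| ^+ m)%:E).
  apply/integrableP; split; first exact/measurable_EFinP.
  by under eq_integral do rewrite gee0_abs ?lee_fin ?exprn_ge0//.
apply: (le_integrable measurableT _ _ (integrableD measurableT
  (finite_measure_integrable_cst P 1 measurableT) im)).
  by apply/measurable_EFinP; exact: measurable_funX.
move=> w _ /=; rewrite lee_fin normrX [leRHS]ger0_norm ?addr_ge0 ?exprn_ge0//.
have [X1|X1] := leP `|X w| 1.
  by rewrite (le_trans (exprn_ile1 _ _ _))// lerDl exprn_ge0.
by rewrite (le_trans (ler_weXn2l (ltW X1) km))// lerDr.
Qed.

(** * Canonical functions as functions of all coordinates *)

Section canonical_functions.
Context (R : realType) (n : nat) (g : forall A : {set 'I_n}, #|A|.-tuple R -> R).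

(* [g A] seen as a function of all the coordinates, with the irrelevant
   functions, those with [#|A| < 2], put to zero *)
Definition canonical_fun (A : {set 'I_n}) (t : n.-tuple R) : R :=
  if (2 <= #|A|)%N then g (subvector A t) else 0.

Lemma canonical_fun_agree A s t : agree A s t -> canonical_fun A s = canonical_fun A t.
Proof.
move=> st; rewrite /canonical_fun; case: ifP => // _; congr g.
apply: eq_from_tnth => k; rewrite !tnth_mktuple; apply: st; exact: enum_valP.
Qed.

Lemma U_statE t : U_stat g t = \sum_A canonical_fun A t.
Proof. by rewrite /U_stat big_mkcond. Qed.

Context d (T : measurableType d) (Q : probability T R).
Variables (F : 'I_n -> cumulativeBounded (0 : R) (1 : R)).
Variables (H : ('I_n -> R) -> \bar R) (xi : 'I_n -> {RV Q >-> R}).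
Hypothesis g_canonical : canonical_functions F H xi g.

Lemma measurable_canonical_fun A : measurable_fun setT (canonical_fun A).
Proof.
rewrite /canonical_fun; have [A2|_] := boolP (2 <= #|A|)%N; last exact: measurable_cst.
have [mg _ _ _ _] := g_canonical.
by apply: measurableT_comp; [exact: mg|exact: measurable_subvector].
Qed.

Lemma canonical_fun_integrable A : (law xi).-integrable setT (EFin \o canonical_fun A).
Proof.
have mG : measurable_fun setT (EFin \o canonical_fun A).
  by apply/measurable_EFinP; exact: measurable_canonical_fun.
apply/(integrable_law xi mG)/integrableP; split.
  exact: measurableT_comp mG (measurable_random_vector xi).
have [_ ig _ _ _] := g_canonical.
rewrite /canonical_fun; have [A2|_] := boolP (2 <= #|A|)%N.
  by have := ig A A2; rewrite unlock.
by rewrite integral0_eq ?ltry// => w _; rewrite /= normr0.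
Qed.

(** The event that [xi] lies in [C] belongs to the conditioning sigma-algebra, so the integral
    equals that of the version [Z], which is almost surely zero. *)
Lemma canonical_fun_integral0 (A : {set 'I_n}) k : k \in A -> forall C, measurable C ->
  (forall s t, agree (A :\ k) s t -> C s -> C t) ->
  (\int[law xi]_(t in C) (canonical_fun A t)%:E = 0)%E.
Proof.
move=> kA C mC CA; have mGA := measurable_canonical_fun A.
have mGC : measurable_fun setT ((EFin \o canonical_fun A) \_ C).
  apply: (measurable_restrictT _ _).1 => //.
  by apply: measurable_funTS; exact/measurable_EFinP.
rewrite integral_mkcond integral_law//.
rewrite (_ : (fun w => _) =
    (EFin \o canonical_fun A \o random_vector xi) \_ (random_vector xi @^-1` C)); last first.
  by apply/funext => w; rewrite !patchE; congr (if _ then _ else _).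
rewrite -integral_mkcond.
have [A2|A2] := boolP (2 <= #|A|)%N; last first.
  by rewrite integral0_eq// => w _; rewrite /= /canonical_fun (negbTE A2).
have [_ _ g0 _ _] := g_canonical.
have [Z [iZ _ ZE] Z0] := g0 A A2 k kA.
have mrC : measurable (random_vector xi @^-1` C).
  by rewrite -[X in measurable X]setTI; exact: measurable_random_vector.
transitivity (\int[Q]_(w in random_vector xi @^-1` C) (Z w)%:E)%E.
  rewrite ZE; last exact: sigma_generated_agree.
  by apply: eq_integral => w _; rewrite /= /canonical_fun A2.
rewrite (ae_eq_integral (cst 0%E))//.
- by rewrite integral0.
- by apply: measurable_funTS; exact: measurable_int iZ.
- by apply: filterS Z0 => w /= -> _.
Qed.
End canonical_functions.

Theorem theorem5p7 (R : realType) (n alpha : nat) (hn : (2 <= n)%N)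
    (d : measure_display) (T : measurableType d) (P : probability T R)
    (d' : measure_display) (T' : measurableType d') (Q : probability T' R)
    (F : 'I_n -> cumulativeBounded (0 : R) (1 : R))
    (X : 'I_n -> {RV P >-> R}) (xi : 'I_n -> {RV Q >-> R})
    (g : forall A : {set 'I_n}, #|A|.-tuple R -> R)
    (X_cdf : forall i x, cdf (X i) x = (F i x)%:E)
    (X_ac : abs_continuous_wrt_product F (joint_cdf X))
    (xi_indep : mutually_independent xi)
    (xi_cdf : forall i x, cdf (xi i) x = (F i x)%:E)
    (g_canonical : canonical_functions F (joint_cdf X) xi g)
    (X_moments : forall j, ('E_P[fun w => (`|X j w| ^+ alpha)%R] < +oo)%E) :
  multiplicative_system alpha X <->
  (forall A : {set 'I_n}, (2 <= #|A|)%N ->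
   forall a : 'I_n -> nat, (forall j, (a j <= alpha)%N) ->
     ('E_Q[fun w => ((\prod_(i in A) xi i w ^+ a i) *
                     g A (subvector A (random_vector xi w)))%R] = 0)%E).
Proof.
have [mg ig g0 U1 XU] := g_canonical.
pose gam := canonical_fun g.
have mgam : forall A, measurable_fun setT (gam A) by exact: measurable_canonical_fun g_canonical.
have muc A x : law xi (cylinder A x) = (\prod_(i in A) (F i (x i))%:E)%E.
  rewrite law_cylinder//; apply: eq_bigr => i _; exact: xi_cdf.
(* Equal marginal cdfs carry the moments of [X i] over to [xi i]. *)
have EX i (h : R -> R) : measurable_fun setT h ->
    (\int[P]_w (h (X i w))%:E = \int[Q]_w (h (xi i w))%:E)%E.
  by apply: eq_cdf_integral => x; rewrite X_cdf xi_cdf.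
have mpow i k : measurable_fun setT (fun t : n.-tuple R => (tnth t i ^+ k)%:E).
  by apply/measurable_EFinP; apply: measurable_funX; exact: measurable_tnth.
have ipow i k : (k <= alpha)%N ->
    (law xi).-integrable setT (fun t => (tnth t i ^+ k)%:E).
  move=> ka; apply/(integrable_law xi (mpow i k)).
  rewrite (_ : _ \o _ = fun w => (xi i w ^+ k)%:E); last first.
    by apply/funext => w; rewrite /= tnth_mktuple.
  apply: integrable_power ka _; first exact: measurable_funP.
  have := X_moments i; rewrite unlock (EX i (fun x => `|x| ^+ alpha))//.
  by apply: measurable_funX; exact: normr_measurable.
have Epow i k : ('E_P[fun w => (X i w ^+ k)%R] =
    \int[law xi]_t (tnth t i ^+ k)%:E)%E.
  rewrite unlock (EX i (fun x => x ^+ k)); last exact: measurable_funX.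
  rewrite integral_law//; apply: eq_integral => w _.
  by rewrite tnth_mktuple.
have mU : measurable_fun setT (fun t => 1 + U_stat g t).
  apply: measurable_funD => //.
  rewrite (_ : U_stat g = fun t => \sum_A gam A t); first exact: measurable_sum.
  by apply/funext => t; exact: U_statE.
have U0 : {ae Q, forall w, 0 <= 1 + U_stat g (random_vector xi w)}.
  by apply: filterS U1 => w; rewrite -lerBlDl sub0r.
(* Passage from the law of [X] to that of [xi] through the density [1 + U_n]. *)
have EM a : ('E_P[fun w => (\prod_(j < n) X j w ^+ a j)%R] =
    \int[law xi]_t (monomial [set: 'I_n]%SET a t * (1 + \sum_A gam A t))%:E)%E.
  have mM := measurable_monomial (R := R) [set: 'I_n]%SET a.
  under [RHS]eq_integral do rewrite -U_statE.
  rewrite -(integral_law_density xi_indep xi_cdf mU U0 XU mM).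
  rewrite integral_law; last exact/measurable_EFinP.
  rewrite unlock; apply: eq_integral => w _; congr EFin.
  by apply: eq_big => [i|i _]; rewrite ?inE ?tnth_mktuple.
have Eg (A : {set 'I_n}) a : (2 <= #|A|)%N ->
    ('E_Q[fun w => ((\prod_(i in A) xi i w ^+ a i) *
                     g A (subvector A (random_vector xi w)))%R] =
     \int[law xi]_t (monomial A a t * gam A t)%:E)%E.
  move=> A2; rewrite integral_law; last first.
    apply/measurable_EFinP; apply: measurable_funM => //.
    exact: measurable_monomial.
  rewrite unlock; apply: eq_integral => w _; rewrite /gam /canonical_fun A2.
  congr (EFin (_ * _)); apply: eq_bigr => i _.
  by rewrite tnth_mktuple.
have gam0 := canonical_fun_integral0 g_canonical.
have igam := canonical_fun_integrable g_canonical.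
have gamA := @canonical_fun_agree R n g.
split=> [[_ H] A A2 a aa|H].
  rewrite Eg//; apply: (gam_of_moment (G := fun i x => (F i x)%:E)
    muc gamA igam gam0 ipow) => // b bb.
  apply: (etrans (esym (EM b))); rewrite H//; apply: eq_bigr => i _; exact: Epow.
split=> // a aa; rewrite EM.
under [RHS]eq_bigr do rewrite Epow.
apply: (moment_of_gam (G := fun i x => (F i x)%:E) muc gamA igam ipow) => // A.
(* For fewer than two indices [gam A] is zero by construction. *)
have [A2|A2] := boolP (2 <= #|A|)%N.
  by apply: (etrans (esym (Eg A a A2))); exact: H.
by rewrite integral0_eq// => t _; rewrite /gam /canonical_fun (negbTE A2) mulr0.
Qed.
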